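(* Let $(G,+,0,d)$ be a strictly convex metric group whose underlying topological space (with the topology generated by $d$) is locally compact. Then $G$ is abelian, i.e. $x+y=y+x$ for all $x,y\in G$.
   Context: A metric space $(X,d)$ is strictly convex if for any points $x,y\in X$ and any positive real numbers $a,b$ with $a+b=d(x,y)$, the intersection $B[x,a]\cap B[y,b]$ is a singleton, where $B[x,a]=\{z\in X: d(x,z)\le a\}$ is the closed ball. A metric group is a (not necessarily commutative, additively written) group $(G,+,0)$ equipped with a metric $d:G\times G\to\mathbb{R}$ that is two-sided translation invariant: $d(x+c,y+c)=d(x,y)=d(c+x,c+y)$ for all $x,y,c\in G$. It is strictly convex if the metric space $(G,d)$ is strictly convex. A topological space $X$ is locally compact if every $x\in X$ has an open neighborhood $U$ whose closure $\overline{U}$ is compact. *)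

(* Defs.v *)
From HB Require Import structures.
From mathcomp Require Import all_boot all_order all_algebra.
From mathcomp Require Import all_classical all_reals all_analysis.

Set Implicit Arguments.
Unset Strict Implicit.
Unset Printing Implicit Defensive.

Import Order.TTheory GRing.Theory Num.Theory.

Local Open Scope classical_set_scope.
Local Open Scope ring_scope.

(* The group law, possibly non-commutative, is that of [groupType], hence
   multiplicative: [x * y] and [1] in group_scope stand for x + y and 0. *)
HB.mixin Record isTranslationInvariant (K : numDomainType) G
    & Group G & Metric K G := {
  mdistMr : forall x y c : G, mdist (x * c)%g (y * c)%g = mdist x y ;
  mdistMl : forall x y c : G, mdist (c * x)%g (c * y)%g = mdist x y
}.

#[short(type="metricGroupType")]
HB.structure Definition MetricGroup (K : numDomainType) :=
  { G of Group G & Metric K G & isTranslationInvariant K G }.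

(* Not [closed_ball], which is the closure of the open ball and can be
   strictly smaller in a metric space. *)
Definition mclosed_ball (K : numDomainType) (X : metricType K) (x : X) (a : K)
  : set X := [set z | mdist x z <= a].

Definition strictly_convex (K : numDomainType) (X : metricType K) : Prop :=
  forall (x y : X) (a b : K), 0 < a -> 0 < b -> a + b = mdist x y ->
    exists z : X, mclosed_ball x a `&` mclosed_ball y b = [set z].

Lemma locally_compactTP (X : topologicalType) :
  locally_compact [set: X] <->
  forall x : X, exists U : set X, [/\ open U, U x & compact (closure U)].
Proof.
split=> [lc x|lc x _].
- have [C + [cC clC]] := lc x I; rewrite withinET => Cx.
  exists (interior C); split; [exact: open_interior | exact: Cx |].
  apply: (subclosed_compact _ cC); first exact: closed_closure.
  rewrite [X in _ `<=` X](closure_id C).1//.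
  by apply: closureS; exact: interior_subset.
- have [U [oU Ux cU]] := lc x; exists (closure U).
    rewrite withinET; apply: filterS (@subset_closure _ U) _.
    exact: open_nbhs_nbhs.
  by split=> //; exact: closed_closure.
Qed.

(* Main.v *)
(* Uniqueness of midpoints makes halves canonical: a half z of x, i.e. a midpoint
   of 1 and x, satisfies z^2 = x and commutes with whatever commutes with x.
   Hence G has no 2-torsion, every a is the half of a^2, and the length
   N x = d(1, x) satisfies N (a^2) = 2 N a.  A conjugation-invariant length with
   this property vanishes on commutators (Fritz, Gadgil, Khare, Nielsen,
   Silberman and Tao, "Homogeneous length functions on groups"): if w y is
   conjugate to z w^-1 then N (w y) <= (N y + N z) / 2, which for
   f(m, k) = N (x^m [x,y]^k) gives
   f(m, k) <= (f(m - 1, k) + f(m + 1, k - 1)) / 2.  Following this random walk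
   for 2n steps from (0, n) leads back to the origin on average, so
   n N [x,y] <= f(0, n) = O(sqrt n), and N [x,y] = 0. *)

Require Import Defs.
From mathcomp Require Import all_boot all_order all_algebra.
From mathcomp Require Import all_classical all_reals all_analysis.
From mathcomp Require Import ring lra.

Import Order.TTheory GRing.Theory Num.Theory.

Local Open Scope classical_set_scope.
Local Open Scope group_scope.

(** Removes a bounded additive error from estimates on powers of two. *)
Lemma ler_exp2_lim (R : realType) (a b C : R) :
  (forall j : nat, 2 ^+ j * a <= 2 ^+ j * b + C)%R -> (a <= b)%R.
Proof.
move=> abC; rewrite leNgt; apply/negP => ba.
have d0 : (0 < a - b)%R by rewrite subr_gt0.
have := truncnS_gt (C / (a - b))%R; rewrite ltr_pdivrMr //.
set n := (_.+1)%N => Cn.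
have n2 : (n%:R <= 2 ^+ n :> R)%R by rewrite -natrX ler_nat ltnW // ltn_expl.
have := abC n.
have : (n%:R * (a - b) <= 2 ^+ n * (a - b))%R by rewrite ler_pM2r.
lra.
Qed.

Section IntegerPowers.
Context {G : groupType}.
Implicit Types x : G.

Definition zexpg x (m : int) : G :=
  match m with Posz n => x ^+ n | Negz n => x ^- n.+1 end.

Lemma zexpgS x m : zexpg x (m + 1)%R = x * zexpg x m.
Proof.
case: m => [n|[|n]]; first by rewrite -PoszD addn1 /= expgS.
  by rewrite /= expg1 mulgV.
have -> : (Negz n.+1 + 1 = Negz n)%R by rewrite !NegzE; ring.
by rewrite /= [x ^+ n.+2]expgSr invgM mulVKg.
Qed.

Lemma zexpgSr x m : zexpg x (m + 1)%R = zexpg x m * x.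
Proof.
case: m => [n|[|n]]; first by rewrite -PoszD addn1 /= expgSr.
  by rewrite /= expg1 mulVg.
have -> : (Negz n.+1 + 1 = Negz n)%R by rewrite !NegzE; ring.
by rewrite /= [x ^+ n.+2]expgS invgM mulgVK.
Qed.

End IntegerPowers.

Record homogeneous_length {R : realType} {G : groupType} (N : G -> R) : Prop := {
  length1 : N 1 = 0%R ;
  lengthM : forall x y, (N (x * y)%g <= N x + N y)%R ;
  lengthV : forall x, N x^-1 = N x ;
  lengthJ : forall x g, N (x ^ g) = N x ;
  length_sqr : forall x, (2 * N x <= N (x * x)%g)%R }.

Section HomogeneousLength.
Context {R : realType} {G : groupType} {N : G -> R} (HN : homogeneous_length N).
Implicit Types x y z w g u : G.

Lemma lengthC x y : N (x * y) = N (y * x).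
Proof. by rewrite -[RHS](lengthJ _ HN _ y) conjgE -mulgA mulKg. Qed.

Lemma length_ge0 x : (0 <= N x)%R.
Proof.
by have := lengthM _ HN x x^-1; rewrite mulgV length1 // lengthV //; lra.
Qed.

Lemma lengthX x n : (N (x ^+ n)%g <= n%:R * N x)%R.
Proof.
elim: n => [|n IHn]; first by rewrite expg0 length1 // mul0r.
by rewrite expgS (le_trans (lengthM _ HN _ _)) // -natr1; lra.
Qed.

Lemma lengthX_exp2 x j : (2 ^+ j * N x <= N (x ^+ (2 ^ j))%g)%R.
Proof.
elim: j => [|j IHj]; first by rewrite expg1 mul1r.
rewrite expnSr expgnA expg2 exprS.
by have := length_sqr _ HN (x ^+ (2 ^ j)); lra.
Qed.

Lemma length_zexpg x m : (N (zexpg x m) <= `|m|%:~R * N x)%R.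
Proof.
case: m => n; first exact: lengthX.
by rewrite /= lengthV // NegzE normrN; exact: lengthX.
Qed.

(** With a = w y and b = z w^-1 = a^g, the power a^(2n) equals a^n g b^n g^-1, so g costs at most 2
    N g, negligible against n = 2^j. *)
Lemma length_conj_avg w y z g : (w * y) ^ g = z * w^-1 ->
  (2 * N (w * y)%g <= N y + N z)%R.
Proof.
move=> wyg; set a := w * y; set b := z * w^-1.
(* The outermost factors w and w^-1 cancel by conjugation invariance. *)
have cancel_ends n u : (N (a ^+ n * u * b ^+ n)%g <= n%:R * (N y + N z) + N u)%R.
  elim: n => [|n IHn]; first by rewrite !expg0 mul1g mulg1 mul0r add0r.
  set v := a ^+ n * u * b ^+ n.
  have -> : a ^+ n.+1 * u * b ^+ n.+1 = w * (y * v * z) * w^-1.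
    by rewrite expgS expgSr /v !mulgA.
  rewrite lengthC mulKg -natr1.
  have := lengthM _ HN (y * v) z; have := lengthM _ HN y v.
  by rewrite -/v in IHn; lra.
apply: (@ler_exp2_lim R _ _ (2 * N g)%R) => j.
have := lengthX_exp2 a j.+1.
rewrite expnS mul2n -addnn expgnDr exprS.
have -> : a ^+ (2 ^ j) * a ^+ (2 ^ j) =
    a ^+ (2 ^ j) * g * b ^+ (2 ^ j) * g^-1.
  by rewrite /b -wyg -conjXg conjgE !mulgA !mulgK.
have := lengthM _ HN (a ^+ (2 ^ j) * g * b ^+ (2 ^ j)) g^-1.
by have := cancel_ends (2 ^ j)%N g; rewrite lengthV // natrX; lra.
Qed.

End HomogeneousLength.

(* [F] is dominated by its mean over one step of the walk with increments (-1, 0)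
   and (1, -1); the bound is the exact expectation of the quadratic function after
   [n] steps. *)
Lemma walk_quadratic_bound (R : realType) (F : int -> int -> R) (a b c : R) :
  (forall m k, 2 * F m k <= F (m - 1) k + F (m + 1) (k - 1))%R ->
  (forall m k, F m k <= a * m%:~R ^+ 2 + b * k%:~R ^+ 2 + c)%R ->
  forall (n : nat) m k, (F m k <=
    a * (m%:~R ^+ 2 + n%:R) + b * ((k%:~R - n%:R / 2) ^+ 2 + n%:R / 4) + c)%R.
Proof.
move=> Fstep F0; elim=> [|n IHn] m k; first by have := F0 m k; lra.
have := IHn (m - 1)%R k; have := IHn (m + 1)%R (k - 1)%R; have := Fstep m k.
by rewrite !(intrD, intrN, mulr1z) -[n.+1%:R%R]natr1; lra.
Qed.

Lemma homogeneous_length_commutator (R : realType) (G : groupType) (N : G -> R) :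
  homogeneous_length N -> forall x y, N (x * y * x^-1 * y^-1) = 0%R.
Proof.
move=> HN x y; set c := x * y * x^-1 * y^-1.
pose F m k := N (zexpg x m * zexpg c k).
have Fstep m k : (2 * F m k <= F (m - 1) k + F (m + 1) (k - 1))%R.
  rewrite /F; set u := zexpg x (m - 1) * _.
  have Ex : zexpg x m * zexpg c k = x * u.
    by rewrite /u mulgA -zexpgS subrK.
  have Ec : zexpg x m * zexpg c k = zexpg x m * zexpg c (k - 1) * c.
    by rewrite -mulgA -zexpgSr subrK.
  (* Put P = x^m c^(k-1). Since c y = x y x^-1, conjugating P c by y gives (P x)^y x^-1, the form z
     w^-1 with w = x. *)
  rewrite zexpgS -mulgA (lengthC HN x) Ex -(lengthJ _ HN (_ * x) y).
  apply: (length_conj_avg HN _ _ _ y).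
  by rewrite -Ex Ec /c !conjgE !mulgA !mulgVK.
set A := N x; set B := N c.
have A0 : (0 <= A)%R := length_ge0 HN x.
have B0 : (0 <= B)%R := length_ge0 HN c.
apply/eqP; rewrite eq_le (length_ge0 HN) andbT.
(* With L = 2^j, the walk bound after 2 L^2 steps from (0, L^2) is L times this constant, while the
   length there is at least L^2 N c. *)
apply: (@ler_exp2_lim R _ _ (3 / 2 * A + 3 / 4 * B)%R) => j.
rewrite mulr0 add0r; set L : R := (2 ^+ j)%R.
have L0 : (0 < L)%R by rewrite exprn_gt0.
(* The walk starts at (0, n) with n = L ^ 2; this weight balances the linear and
   the variance terms of its bound after 2n steps. *)
have F0 m k : (F m k <=
    A / (2 * L) * m%:~R ^+ 2 + B / (2 * L) * k%:~R ^+ 2 + (A + B) * L / 2)%R.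
  have amgm (i : int) : (`|i|%:~R <= (2 * L)^-1 * i%:~R ^+ 2 + L / 2 :> R)%R.
    rewrite intr_norm -[X in (_ * X)%R]real_normK ?num_real //.
    rewrite -subr_ge0; set t : R := `|_|%R.
    have -> : ((2 * L)^-1 * t ^+ 2 + L / 2 - t = (2 * L)^-1 * (t - L) ^+ 2)%R.
      by field; rewrite gt_eqF.
    by rewrite mulr_ge0 ?sqr_ge0 // invr_ge0 mulr_ge0 // ltW.
  have := lengthM _ HN (zexpg x m) (zexpg c k).
  have := length_zexpg HN x m; have := length_zexpg HN c k.
  have := ler_wpM2r A0 (amgm m); have := ler_wpM2r B0 (amgm k).
  rewrite /F -/A -/B; lra.
have := @walk_quadratic_bound R F _ _ _ Fstep F0 (2 * 2 ^ (j * 2))%N 0%R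
  (2 ^ (j * 2))%N%:Z.
have := lengthX_exp2 HN c (j * 2)%N.
rewrite {1}/F /= expg0 mul1g natrM -pmulrn natrX exprM -/L => Nc Fc.
have {Nc Fc} := le_trans Nc Fc.
have -> : (A / (2 * L) * (0 ^+ 2 + 2%:R * L ^+ 2) + B / (2 * L) *
  ((L ^+ 2 - 2%:R * L ^+ 2 / 2) ^+ 2 + 2%:R * L ^+ 2 / 4) + (A + B) * L / 2 =
  L * (3 / 2 * A + 3 / 4 * B))%R by field; rewrite gt_eqF.
by rewrite expr2 -mulrA ler_pM2l.
Qed.

Section StrictlyConvexGroup.
Context {R : realType} {G : metricGroupType R} (Gconvex : strictly_convex G).
Implicit Types x y z g u : G.

Definition is_half x z := (2 * mdist 1%g z <= mdist 1%g x)%R /\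
  (2 * mdist x z <= mdist 1%g x)%R.

Lemma ex_half x : exists z, is_half x z.
Proof.
(* Strict convexity needs positive radii, so x = 1 is treated apart. *)
have [->|x1] := eqVneq x 1; first by exists 1; split; rewrite mdistxx; lra.
have d0 : (0 < mdist 1%g x / 2)%R by rewrite divr_gt0 // mdist_gt0 eq_sym.
have [|z zE] := Gconvex 1 x _ _ d0 d0; first by lra.
have [] : (mclosed_ball 1 (mdist 1%g x / 2) `&` mclosed_ball x (mdist 1 x / 2)) z.
  by rewrite zE.
by rewrite /mclosed_ball /= => ? ?; exists z; split; lra.
Qed.

Lemma half_unique x z1 z2 : is_half x z1 -> is_half x z2 -> z1 = z2.
Proof.
move=> [h1 h1'] [h2 h2'].
have [x1|x1] := eqVneq x 1.
  move: h1 h2; rewrite x1 mdistxx => h1 h2.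
  suff eq1 z : (2 * mdist 1%g z <= 0)%R -> 1 = z.
    by rewrite -(eq1 z1) // -(eq1 z2).
  by move=> hz; apply: mdist_positivity; have := mdist_ge0 1 z; lra.
have d0 : (0 < mdist 1%g x / 2)%R by rewrite divr_gt0 // mdist_gt0 eq_sym.
have [|z zE] := Gconvex 1 x _ _ d0 d0; first by lra.
have inz t : is_half x t -> t = z.
  move=> [t1 t2]; suff : [set z] t by [].
  by rewrite -zE; split; rewrite /mclosed_ball /=; lra.
by rewrite (inz z1) // (inz z2).
Qed.

Lemma mdistV x : mdist 1 x^-1 = mdist 1 x.
Proof. by rewrite -(mdistMr _ _ x) mul1g mulVg metric_sym. Qed.

Lemma mdistJ x y g : mdist (x ^ g) (y ^ g) = mdist x y.
Proof. by rewrite !conjgE mdistMl mdistMr. Qed.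

Lemma mdist1J x g : mdist 1 (x ^ g) = mdist 1 x.
Proof. by rewrite -{1}(conj1g g) mdistJ. Qed.

(* The isometry [z |-> x * z^-1] swaps [1] and [x], hence fixes their midpoint. *)
Lemma half_sqr x z : is_half x z -> z * z = x.
Proof.
move=> hz; suff xz : x * z^-1 = z by rewrite -{1}xz mulgVK.
apply: half_unique (hz); case: hz => h1 h2; split.
  by rewrite -(mdistMr _ _ z) mul1g mulgVK metric_sym.
by rewrite -{1}(mulg1 x) mdistMl mdistV.
Qed.

(** Conjugation by g is an isometry fixing 1 and x, hence their midpoint. *)
Lemma half_commute x z g : is_half x z -> commute x g -> commute z g.
Proof.
move=> hz xg; have xJ : x ^ g = x by rewrite conjgE xg mulKg.
have zJ : z ^ g = z.
  apply: half_unique (hz); case: hz => h1 h2; split; first by rewrite mdist1J.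
  by rewrite -{1}xJ mdistJ.
by rewrite /commute conjgC zJ.
Qed.

(** If v is a half of u = u^-1, so is v^-1, because d(v^-2, v^-1) = d(1, v); thus v^-1 = v and u = v
    v = 1. *)
Lemma no_2torsion u : u * u = 1 -> u = 1.
Proof.
move=> uu; have [v hv] := ex_half u; have vv := half_sqr _ _ hv.
have uV : u^-1 = u by apply: mulg1_eq.
suff vV : v^-1 = v by rewrite -vv -{1}vV mulVg.
apply: half_unique (hv); case: hv => h1 h2; split; first by rewrite mdistV.
suff -> : mdist u v^-1 = mdist 1 v by [].
rewrite -uV -{1}vv invgM -{3}(mulg1 v^-1) mdistMl.
by rewrite metric_sym mdistV.
Qed.

(** A half z of x^2 commutes with x, so (z x^-1)^2 = z^2 x^-2 = 1 and z = x. *)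
Lemma half_of_sqr x : is_half (x * x) x.
Proof.
have [z hz] := ex_half (x * x); suff zx : z = x by rewrite zx in hz.
have zx : commute z x by apply: half_commute hz _; rewrite /commute mulgA.
apply: divg1_eq; apply: no_2torsion; rewrite -expg2 (expgnFl 2 zx) !expg2.
by rewrite (half_sqr _ _ hz) mulgV.
Qed.

Lemma mdist1_homogeneous : homogeneous_length (fun x : G => mdist 1 x).
Proof.
split=> [|x y|x|x g|x].
- exact: mdistxx.
- rewrite (le_trans (metric_triangle _ x _)) // lerD2l.
  by rewrite -{1}(mulg1 x) mdistMl.
- exact: mdistV.
- exact: mdist1J.
- by have [] := half_of_sqr x.
Qed.

End StrictlyConvexGroup.

Theorem theorem5 (R : realType) (G : metricGroupType R)
    (Gconvex : strictly_convex G) (Glc : locally_compact [set: G]) :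
  forall x y : G, x * y = y * x.
Proof.
move=> x y.
have /mdist_positivity :=
  homogeneous_length_commutator _ _ _ (mdist1_homogeneous Gconvex) x y.
by move=> /esym/divg1_eq /(congr1 (fun t => t * x)); rewrite mulgVK.
Qed.
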